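(* Let $G$ be a finite, undirected, simple, connected graph. Then $G\in\mathbf{m_3}/\mathbf{l_2}$ if and only if $G$ is hole-free. That is, $\mathbf{m_3}/\mathbf{l_2}=\text{hole-free}$.
   Context: All graphs are finite, undirected, simple and connected. A $uv$-walk is a sequence of (not necessarily distinct) vertices $W: u=v_0,v_1,\ldots,v_n=v$ with $v_{i-1}$ adjacent to $v_i$ for all $i\in\{1,\ldots,n\}$; $v_1,\ldots,v_{n-1}$ are its internal vertices and $n$ is its length. A $uv$-path is a $uv$-walk with distinct vertices. A $uv$-induced path is a $uv$-path in which two vertices are adjacent in $G$ if and only if they are consecutive on the path. For non-adjacent vertices $u,v$: - $\mathbf{m_3}(u,v)$ is the set of $uv$-$m_3$ paths, i.e. $uv$-induced paths of length at least three. - $\mathbf{l_2}(u,v)$ is the set of $uv$-$l_2$-paths, i.e. $uv$-induced paths of length at most $2$. Domination: for non-adjacent $u,v$, a $uv$-walk $W$ dominates a $uv$-walk $W'$ if every internal vertex of $W'$ is adjacent to some internal vertex of $W$ or belongs to $W$. The class $\mathbf{A}/\mathbf{B}$ consists of all graphs $G$ such that for every pair of non-adjacent vertices $u,v$ of $G$, every walk $W\in\mathbf{A}(u,v)$ dominates every walk $W'\in\mathbf{B}(u,v)$ (vacuously true if one of the sets is empty). A hole is a chordless cycle with at least five vertices; a graph is hole-free if it contains no hole as an induced subgraph. *)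

(* Defs.v *)
From mathcomp Require Import all_boot.

Set Implicit Arguments.
Unset Strict Implicit.
Unset Printing Implicit Defensive.

Record sgraph := SGraph {
  vert :> finType;
  adj : rel vert;
  adj_sym : symmetric adj;
  adj_irr : irreflexive adj }.

Arguments adj {s} x y.

Definition connected_graph (G : sgraph) : Prop :=
  forall x y : G, connect adj x y.

(* A walk is given by the sequence W = [:: v_0; v_1; ...; v_n] of all its
   vertices, both ends included; its length is the number n of edges. *)
Definition walk (G : sgraph) (u v : G) (W : seq G) : bool :=
  if W is x :: p then [&& x == u, path adj x p & last x p == v] else false.

Definition walk_length (G : sgraph) (W : seq G) : nat := (size W).-1.

(* v_1, ..., v_(n-1) *)
Definition internal (G : sgraph) (W : seq G) : seq G :=
  if W is x :: p then behead (belast x p) else [::].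

Definition is_path (G : sgraph) (u v : G) (W : seq G) : bool :=
  walk u v W && uniq W.

Definition induced_path (G : sgraph) (u v : G) (W : seq G) : Prop :=
  is_path u v W /\
  forall i j : nat, i < size W -> j < size W ->
    adj (nth u W i) (nth u W j) <-> (j = i.+1 \/ i = j.+1).

Definition walk_family := forall G : sgraph, G -> G -> seq G -> Prop.

Definition m3 : walk_family := fun G u v W =>
  induced_path u v W /\ 3 <= walk_length W.

Definition l2 : walk_family := fun G u v W =>
  induced_path u v W /\ walk_length W <= 2.

Definition dominates (G : sgraph) (W W' : seq G) : Prop :=
  forall x : G, x \in internal W' ->
    (exists2 y : G, y \in internal W & adj x y) \/ x \in W.

(* The class A/B; non-adjacent vertices are understood to be distinct. *)
Definition dom_class (A B : walk_family) (G : sgraph) : Prop :=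
  forall u v : G, u != v -> ~~ adj u v ->
    forall W W' : seq G, A G u v W -> B G u v W' -> dominates W W'.

(* A cycle is the cyclic sequence of its distinct vertices; a chord is an edge
   of G joining two vertices of the cycle that are not consecutive on it. *)
Definition is_cycle (G : sgraph) (c : seq G) : bool :=
  [&& 3 <= size c, cycle adj c & uniq c].

Definition chord (G : sgraph) (c : seq G) (x y : G) : Prop :=
  [/\ x \in c, y \in c, adj x y, next c x <> y & next c y <> x].

Definition hole (G : sgraph) (c : seq G) : Prop :=
  [/\ is_cycle c, 5 <= size c & forall x y : G, ~ chord c x y].

Definition hole_free (G : sgraph) : Prop := forall c : seq G, ~ hole c.

(* Main.v *)
Require Import Defs.
From mathcomp Require Import all_boot.

(** A hole with a distinguished vertex [x] is the same
    thing as an induced path of length at least three, closed up by a vertex [x]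
    off the path that is adjacent to both ends and to no internal vertex.  Such an
    [x] is exactly the internal vertex of an induced path of length two that the
    long path fails to dominate. *)

(** The default [x] on the right encodes the wrap-around: past the last entry of [p] the cycle
    returns to its head [x]. The default [y] on the left is irrelevant. *)
Lemma next_cons_nth (T : eqType) (x y : T) (p : seq T) (i : nat) :
  uniq (x :: p) -> i < size p -> next (x :: p) (nth y p i) = nth x p i.+1.
Proof.
move=> xp_uniq lt_ip; rewrite (set_nth_default x y lt_ip) next_nth.
by rewrite -[nth x p i]/(nth x (x :: p) i.+1) mem_nth // index_uniq.
Qed.

(** An edge between two cycle vertices either meets [x] or stays inside the path, so chordlessness
    splits into the condition on the neighbours of [x] and inducedness. The bound on [m] makes the
    path length at least three and the cycle size at least five. *)
Lemma hole_apexP (G : sgraph) (x u v : G) (m : seq G) :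
  1 < size m ->
  hole (x :: u :: rcons m v) <->
  [/\ induced_path u v (u :: rcons m v), x \notin u :: rcons m v,
      adj x u, adj x v & {in m, forall y, ~~ adj x y}].
Proof.
move=> m_gt1; set p := u :: rcons m v.
have p_last : nth u p (size m).+1 = v by rewrite /= nth_rcons ltnn eqxx.
have size_p : size p = (size m).+2 by rewrite /= size_rcons.
split=> [[/and3P[_ c_cycle c_uniq] _ nchord] | [[p_path p_ind] xNp xu xv xNm]].
- have [xNp p_uniq] := andP c_uniq.
  have /and3P[xu um] : [&& adj x u, path adj u (rcons m v) & adj v x].
    by move: c_cycle; rewrite /= rcons_path last_rcons.
  rewrite adj_sym => xv.
  split=> //; last first.
    move=> y ym; apply/negP => xy; apply: (nchord x y).
    have yp : y \in p by rewrite inE mem_rcons inE ym !orbT.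
    split=> //; [exact: mem_head | by rewrite inE yp orbT | |].
      rewrite /= eqxx => uy; move: p_uniq.
      by rewrite /= uy mem_rcons inE ym orbT.
    (* The leading [u] shifts positions by one; since [v] still follows [y], the successor of [y]
       lies on [p] and is not [x]. *)
    have ltym : index y m < size m by rewrite index_mem.
    have -> : y = nth u p (index y m).+1 by rewrite /= nth_rcons ltym nth_index.
    rewrite next_cons_nth // ?size_p ?ltnS 1?ltnW // => nx.
    by move: xNp; rewrite -nx mem_nth // size_p.
  split=> [|i j lt_ip lt_jp].
    by apply/andP; split=> //; apply/and3P; split=> //; rewrite last_rcons.
  have next_eq k l : k < size p -> l < size p ->
      next (x :: p) (nth u p k) = nth u p l -> l = k.+1.
    move=> lt_kp lt_lp; rewrite next_cons_nth // (set_nth_default x u lt_lp).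
    (* At the end of [p] the successor is [x], which is not on [p]. *)
    have [lt_k1|ge_k1] := ltnP k.+1 (size p).
      by move/eqP; rewrite nth_uniq // => /eqP.
    rewrite nth_default // => xE.
    by move: xNp; rewrite xE mem_nth.
  split=> [ij|].
    (* If neither vertex succeeds the other on the cycle, the edge is a chord. *)
    case: (eqVneq (next (x :: p) (nth u p i)) (nth u p j)) => [|/eqP Ni].
      by move/next_eq; left; auto.
    case: (eqVneq (next (x :: p) (nth u p j)) (nth u p i)) => [|/eqP Nj].
      by move/next_eq; right; auto.
    by case: (nchord (nth u p i) (nth u p j)); split=> //;
       rewrite inE mem_nth // orbT.
  have adjS k : k.+1 < size p -> adj (nth u p k) (nth u p k.+1).
    by move=> lt_k; apply: (pathP u um).
  by case=> E; [|rewrite adj_sym]; rewrite E; apply: adjS; rewrite -E.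
have [/and3P[_ um _] p_uniq] := andP p_path.
have c_uniq : uniq (x :: p) by apply/andP.
have next_v : next (x :: p) v = x.
  by rewrite -{1}p_last next_cons_nth ?size_p // nth_default // size_p.
have next_x : next (x :: p) x = u by rewrite /= eqxx.
split; [|by rewrite /= size_rcons !ltnS|].
  apply/and3P; split=> //; first by rewrite /= size_rcons.
  rewrite /= rcons_path last_rcons xu um.
  by rewrite adj_sym.
(* No chord meets [x]: its only neighbours on the cycle are [u] and [v]. *)
have xchord y : y \in x :: p -> adj x y ->
    next (x :: p) x = y \/ next (x :: p) y = x.
  rewrite inE => /predU1P[->|]; first by rewrite adj_irr.
  rewrite inE => /predU1P[->|]; first by left.
  rewrite mem_rcons inE => /predU1P[->|/xNm/negP//]; by right.
move=> y z [yc zc yz Nyz Nzy].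
case: (eqVneq y x) yc => [yx _|yx].
  by rewrite yx in yz Nyz Nzy; case: (xchord z).
case: (eqVneq z x) zc => [zx _|zx].
  by move=> yc; rewrite zx adj_sym in yz Nyz Nzy; case: (xchord y).
rewrite !inE (negPf yx) (negPf zx) /= -!in_cons => zp yp.
have [i lt_i yE] : exists2 i, i < size p & nth u p i = y by apply/nthP.
have [j lt_j zE] : exists2 j, j < size p & nth u p j = z by apply/nthP.
move: yz Nyz Nzy; rewrite -yE -zE !next_cons_nth // => yz Nyz Nzy.
(* Both ends now lie on [p], and inducedness makes them consecutive; the successor is in range, so
   its default can be changed. *)
case: (p_ind i j lt_i lt_j) => /(_ yz) [E|E] _.
  by apply: Nyz; rewrite -E; apply: set_nth_default.
by apply: Nzy; rewrite -E; apply: set_nth_default.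
Qed.

Lemma induced_path2 (G : sgraph) (u x v : G) :
  u != v -> ~~ adj u v -> adj x u -> adj x v -> induced_path u v [:: u; x; v].
Proof.
move=> uv Nuv xu xv.
have Nvu : ~~ adj v u by rewrite adj_sym.
have ux : adj u x by rewrite adj_sym.
have vx : adj v x by rewrite adj_sym.
split.
  rewrite /is_path /walk /= !eqxx ux xv !inE (negPf uv) /= orbF andbT.
  by apply/andP; split; apply/eqP=> E; [move: ux|move: xv]; rewrite E adj_irr.
by move=> [|[|[|i]]] [|[|[|j]]] //= _ _;
   rewrite ?adj_irr ?ux ?xu ?xv ?vx ?(negPf Nuv) ?(negPf Nvu);
   split=> //; auto; case.
Qed.

Lemma internal_rcons (G : sgraph) (u v : G) (m : seq G) :
  internal (u :: rcons m v) = m.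
Proof. by rewrite /internal belast_rcons. Qed.

(** Brings a walk into the shape used by [hole_apexP]. *)
Lemma walk_rconsP (G : sgraph) (u v : G) (W : seq G) :
  walk u v W -> 0 < walk_length W -> exists m, W = u :: rcons m v.
Proof.
case: W => // w q /and3P[/eqP-> _]; case/lastP: q => // m z.
by rewrite last_rcons => /eqP-> _; exists m.
Qed.

Theorem theorem9 (G : sgraph) (Gconn : connected_graph G) :
  dom_class m3 l2 G <-> hole_free G.
Proof.
split=> [dom c c_hole | hfree u v uv Nuv W W' [W_ind W_len] [W'_ind W'_len] x].
  have [_ c_size _] := c_hole.
  case: c c_hole c_size => [|x [|u q]] //; case/lastP: q => // m v c_hole.
  rewrite /= size_rcons !ltnS => m_gt1.
  have [p_ind xNp xu xv xNm] := (hole_apexP G x u v m m_gt1).1 c_hole.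
  have size_p : size (u :: rcons m v) = (size m).+2 by rewrite /= size_rcons.
  have p_last : nth u (u :: rcons m v) (size m).+1 = v.
    by rewrite /= nth_rcons ltnn eqxx.
  have uv : u != v.
    have [/andP[_ /andP[uNm _]] _] := p_ind.
    by apply: contraNneq uNm => ->; rewrite mem_rcons mem_head.
  have Nuv : ~~ adj u v.
    (* These are the positions of [u] and [v]; adjacency would make them consecutive and [m]
       empty. *)
    apply/negP => uv_adj; have [_ /(_ 0 (size m).+1)] := p_ind.
    rewrite p_last size_p => /(_ isT (ltnSn _)) [/(_ uv_adj) [[m0]|//] _].
    by rewrite m0 in m_gt1.
  have p_m3 : m3 u v (u :: rcons m v) by split=> //; rewrite /walk_length size_p.
  have x_l2 : l2 u v [:: u; x; v] by split=> //; apply: induced_path2.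
  have [|[y]|] := dom u v uv Nuv _ _ p_m3 x_l2 x; first exact: mem_head.
    by rewrite internal_rcons => /xNm/negP.
  exact/negP.
have [/andP[W_walk _] _] := W_ind; have [/andP[W'_walk _] _] := W'_ind.
have [m WE] := walk_rconsP G u v W W_walk (ltnW (ltnW W_len)).
have m_gt1 : 1 < size m by move: W_len; rewrite WE /walk_length /= size_rcons.
subst W; rewrite internal_rcons.
(* With fewer than three vertices [W'] has no internal vertex, and with more it is too long. *)
case: W' W'_walk W'_len {W'_ind} => [|u' [|x' [|v' []]]] //.
case/and3P=> /eqP-> /= /and3P[ux' x'v' _] /eqP v'v _; subst v'.
rewrite inE => /eqP->.
have [|xNp] := boolP (x' \in u :: rcons m v); [by right | left].
(* If [x'] has no neighbour in [m] either, it closes the long path into a hole. *)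
have [/hasP[y ym xy]|/hasPn xNm] := boolP (has (adj x') m); first by exists y.
case: (hfree (x' :: u :: rcons m v)); apply/hole_apexP => //.
by split=> //; rewrite adj_sym.
Qed.
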